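(* Let $B$ be a Banach SSD space (Simons space) and $A\subseteq B$ a $q$-positive set. Then: (i) ${}^*\Theta_A=\sup\{h:B\to\overline{\mathbb{R}}: h\text{ proper, convex, lower semicontinuous, }h\geq q\text{ on }B\text{ and }A\subseteq\mathcal{P}(h)\}$. (ii) ${}^*\Theta_A=\operatorname{cl}\operatorname{co}(q+\delta_A)$. If, additionally, $A$ is maximally $q$-positive, then: (iii) $\Lambda_{E^A}=\Phi_A$ and $\Lambda_{\overline{E_A}}={}^*\Theta_A$. (iv) If $h:B\to\overline{\mathbb{R}}$ is a function such that $h\in\mathcal{H}(A)$, then $h^{@}\in\mathcal{H}(A)$.
   Context: A symmetrically self-dual space (SSD space) is a pair $(B,\lfloor\cdot,\cdot\rfloor)$ where $B$ is a nonzero real vector space and $\lfloor\cdot,\cdot\rfloor:B\times B\to\mathbb{R}$ is a symmetric bilinear form. Put $q:B\to\mathbb{R}$, $q(b)=\frac12\lfloor b,b\rfloor$. $B$ is a Banach SSD space (Simons space) if it is an SSD space with a norm $\|\cdot\|$ making it a Banach space with norm-dual $B^*$, such that $\frac12\|\cdot\|^2+q\geq 0$ on $B$ and there exists a linear continuous map $\iota:B\to B^*$ with $\langle b,\iota(c)\rangle=\lfloor b,c\rfloor$ for all $b,c\in B$. A set $A\subseteq B$ is $q$-positive if $A\neq\emptyset$ and $q(b-c)\geq 0$ for all $b,c\in A$; it is maximally $q$-positive if it is $q$-positive and maximal with respect to inclusion among the $q$-positive subsets of $B$. $\mathbb{R}_+=[0,+\infty)$, $\overline{\mathbb{R}}=\mathbb{R}\cup\{\pm\infty\}$.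 A function $f:B\to\overline{\mathbb{R}}$ is proper if it never takes the value $-\infty$ and is not identically $+\infty$. $\delta_A$ is the indicator function of $A$ ($0$ on $A$, $+\infty$ elsewhere); $\operatorname{co}(f)$ is the largest convex function majorized by $f$; $\operatorname{cl}(f)$ is the lower semicontinuous hull of $f$, i.e. the function whose epigraph is the (norm) closure of the epigraph of $f$; the supremum of a family of functions is pointwise. For $f:B\to\overline{\mathbb{R}}$: $\mathcal{P}(f)=\{b\in B:f(b)=q(b)\}$ and $f^{@}(c)=\sup_{b\in B}\{\lfloor b,c\rfloor-f(b)\}$ for $c\in B$. For a $q$-positive set $A$: $\Theta_A:B^*\to\overline{\mathbb{R}}$, $\Theta_A(b^* )=\sup_{a\in A}[\langle a,b^*\rangle-q(a)]$; $\Phi_A:=\Theta_A\circ\iota:B\to\overline{\mathbb{R}}$; ${}^*\Theta_A:B\to\overline{\mathbb{R}}$, ${}^*\Theta_A(c)=\sup_{b^*\in B^*}[\langle c,b^*\rangle-\Theta_A(b^* )]$. The graph of $E:\mathbb{R}_+\rightrightarrows B$ is $G(E)=\{(\varepsilon,b)\in\mathbb{R}_+\times B: b\in E(\varepsilon)\}$, and $\overline{E}:\mathbb{R}_+\rightrightarrows B$ is defined by $\overline{E}(\varepsilon)=\{b\in B:(\varepsilon,b)\in\overline{G(E)}\}$ (closure in the norm topology). $E$ satisfies the transportation formula if for all $\varepsilon_1,\varepsilon_2\geq 0$, $b^1\in E(\varepsilon_1)$, $b^2\in E(\varepsilon_2)$ and all $\alpha_1,\alpha_2\geq 0$ with $\alpha_1+\alpha_2=1$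 one has $\varepsilon:=\alpha_1\varepsilon_1+\alpha_2\varepsilon_2+\alpha_1\alpha_2 q(b^1-b^2)\geq 0$ and $\alpha_1b^1+\alpha_2b^2\in E(\varepsilon)$. $\mathbb{E}(A)$ is the family of multifunctions $E:\mathbb{R}_+\rightrightarrows B$ such that: (r1) $A\subseteq E(\varepsilon)$ for all $\varepsilon\geq 0$; (r2) $0\leq\varepsilon_1\leq\varepsilon_2$ implies $E(\varepsilon_1)\subseteq E(\varepsilon_2)$; (r3) $E$ satisfies the transportation formula. Put $E^A(\varepsilon)=\{b\in B:q(b-c)\geq-\varepsilon\text{ for all }c\in A\}$ and $E_A(\varepsilon)=\bigcap_{E\in\mathbb{E}(A)}E(\varepsilon)$ for $\varepsilon\geq 0$. For $E:\mathbb{R}_+\rightrightarrows B$, $\lambda_E(b)=\inf\{\varepsilon\geq 0:b\in E(\varepsilon)\}$ (with $\inf\emptyset=+\infty$) and $\Lambda_E:=\lambda_E+q$. For $A$ maximally $q$-positive, $\mathcal{H}(A)$ is the family of convex lower semicontinuous functions $h:B\to\overline{\mathbb{R}}$ such that $h\geq q$ on $B$ and $A\subseteq\mathcal{P}(h)$. *)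

(* Defs.v *)
From HB Require Import structures.
From mathcomp Require Import all_boot all_order all_algebra sesquilinear.
From mathcomp Require Import all_classical all_reals.
From mathcomp Require Import interval_inference ereal topology normedtype convex.

Set Implicit Arguments.
Unset Strict Implicit.
Unset Printing Implicit Defensive.

Import Order.TTheory GRing.Theory Num.Theory.
Import numFieldNormedType.Exports.

Local Open Scope classical_set_scope.
Local Open Scope ring_scope.

Section NormDual.
Context {R : realType} {B : normedModType R}.

Definition is_dual : {pred (B -> R^o)} :=
  mem [set f : B -> R^o | linear f /\ continuous f].

Lemma is_dual_submod_closed : submod_closed is_dual.
Proof.
split.
  rewrite inE /=; split; first by move=> a x y; rewrite scaler0 addr0.
  by move=> x; exact: cvg_cst.
move=> a f g; rewrite !inE /= => -[lf cf] [lg cg]; split.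
  move=> k x y; rewrite !fctE lf lg !scalerDr !scalerA (mulrC a).
  by rewrite addrACA.
move=> x; apply: continuousD; last exact: cg.
by apply: continuousZl_tmp; exact: cf.
Qed.

HB.instance Definition _ :=
  GRing.isSubmodClosed.Build R (B -> R^o) is_dual is_dual_submod_closed.

End NormDual.

Record dual (R : realType) (B : normedModType R) :=
  Dual { dual_fun :> B -> R^o ; _ : dual_fun \in is_dual }.

Section NormDualTheory.
Context {R : realType} {B : normedModType R}.

HB.instance Definition _ := [isSub for (@dual_fun R B)].
HB.instance Definition _ := [Choice of dual B by <:].
HB.instance Definition _ := [SubChoice_isSubLmodule of dual B by <:].

Lemma dual_linear (f : dual B) : linear (f : B -> R^o).
Proof. by have := valP f; rewrite inE => -[]. Qed.

HB.instance Definition _ (f : dual B) :=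
  GRing.isLinear.Build R B R^o _ (f : B -> R^o) (dual_linear f).

Lemma dual_continuous (f : dual B) : continuous (f : B -> R^o).
Proof. by have := valP f; rewrite inE => -[]. Qed.

Definition dual_norm (f : dual B) : R :=
  sup [set `|f x| | x in [set x : B | `|x| <= 1]].

Lemma dual_norm_has_sup (f : dual B) :
  has_sup [set `|f x| | x in [set x : B | `|x| <= 1]].
Proof.
split; first by exists `|f 0|, 0 => //=; rewrite normr0.
have /linear_boundedP : bounded_near f (nbhs (0 : B)).
  exact/linear_bounded_continuous/dual_continuous.
move=> /pinfty_ex_gt0[r r0 fr]; exists r => _ [x /= x1 <-].
by rewrite (le_trans (fr x))// ler_piMr// ltW.
Qed.

Lemma dual_norm_ub (f : dual B) (x : B) : `|x| <= 1 -> `|f x| <= dual_norm f.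
Proof.
by move=> x1; apply: (ub_le_sup (dual_norm_has_sup f).2); exists x.
Qed.

Lemma dual_norm_le (f : dual B) (M : R) :
  (forall x : B, `|x| <= 1 -> `|f x| <= M) -> dual_norm f <= M.
Proof.
move=> fM; apply: ge_sup; first exact: (dual_norm_has_sup f).1.
by move=> _ [x /= x1 <-]; exact: fM.
Qed.

Lemma dual_normD (f g : dual B) : dual_norm (f + g) <= dual_norm f + dual_norm g.
Proof.
apply: dual_norm_le => x x1.
by rewrite (le_trans (ler_normD _ _))// lerD// dual_norm_ub.
Qed.

Lemma dual_normZ_le (a : R) (f : dual B) :
  dual_norm (a *: f) <= `|a| * dual_norm f.
Proof.
apply: dual_norm_le => x x1.
by rewrite [leLHS]normrM ler_wpM2l// dual_norm_ub.
Qed.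

Lemma dual_normZ (a : R) (f : dual B) : dual_norm (a *: f) = `|a| * dual_norm f.
Proof.
apply/eqP; rewrite eq_le dual_normZ_le/=.
have [->|a0] := eqVneq a 0.
  rewrite normr0 mul0r; have := @dual_norm_ub (0 *: f) 0.
  by rewrite normr0 ler01 => /(_ isT); apply: le_trans.
rewrite -{1}[f](scalerK a0) mulrC -ler_pdivlMr ?normr_gt0// mulrC.
by rewrite -normfV dual_normZ_le.
Qed.

Lemma dual_norm_eq0 (f : dual B) : dual_norm f = 0 -> f = 0.
Proof.
move=> f0; apply/val_inj/funext => x /=.
have [->|x0] := eqVneq x 0; first exact: linear0.
have nx0 : `|x| != 0 by rewrite normr_eq0.
have := @dual_norm_ub f (`|x|^-1 *: x).
rewrite normrZ normfV normr_id mulVf// lexx f0 => /(_ isT).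
rewrite normr_le0 linearZ/= scaler_eq0 invr_eq0 (negbTE nx0)/= => /eqP fx0.
by rewrite fx0.
Qed.

HB.instance Definition _ :=
  @Lmodule_isNormed.Build R (dual B) dual_norm dual_normD dual_normZ dual_norm_eq0.

End NormDualTheory.

Section ConvexAnalysis.
Context {R : realType} {B : normedModType R}.
Implicit Types f g : B -> \bar R.

Definition proper_fun f := (forall x, f x != -oo%E) /\ (exists x, f x != +oo%E).

Definition epi f : set (B * R^o) := [set p | (f p.1 <= p.2%:E)%E].

(* Convexity through the epigraph needs no convention for +oo - oo, so it also
   covers functions that take the value -oo. *)
Definition convex_fun f := @convex_set R (B * R^o)%type (epi f).

Definition indicator (A : set B) : B -> \bar R :=
  fun x => if x \in A then 0%E else +oo%E.

Definition pointwise_sup (F : set (B -> \bar R)) : B -> \bar R :=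
  fun x => ereal_sup [set f x | f in F].

Definition convex_hull f : B -> \bar R :=
  pointwise_sup [set g | convex_fun g /\ forall x, (g x <= f x)%E].

Definition lsc_hull f : B -> \bar R :=
  fun x => ereal_inf [set r%:E | r in [set r : R | closure (epi f) (x, r)]].

Lemma convex_hull_convex f : convex_fun (convex_hull f).
Proof.
move=> p1 p2 t; rewrite !inE => p1f p2f; apply: ge_ereal_sup => _ [g [cg gf] <-].
have epig p : epi (convex_hull f) p -> p \in epi g.
  move=> pf; rewrite inE; apply: le_trans pf; apply: ereal_sup_ubound.
  by exists g.
by have := cg p1 p2 t (epig _ p1f) (epig _ p2f); rewrite inE.
Qed.

Lemma convex_hull_le f x : (convex_hull f x <= f x)%E.
Proof. by apply: ge_ereal_sup => _ [g [_ gf] <-]. Qed.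

Lemma convex_hull_max f g x : convex_fun g -> (forall y, (g y <= f y)%E) ->
  (g x <= convex_hull f x)%E.
Proof. by move=> cg gf; apply: ereal_sup_ubound; exists g. Qed.

Lemma epi_lsc_hull f : epi (lsc_hull f) = closure (epi f).
Proof.
have up (x : B) (r s : R) : r <= s ->
    closure (epi f) (x, r) -> closure (epi f) (x, s).
  move=> rs cfr; pose h (p : B * R^o) : B * R^o := (p.1, p.2 + (s - r)).
  have ch : continuous h.
    move=> p; apply: (@cvg_pair _ _ _ _ (nbhs p.1) (nbhs (p.2 + (s - r)))).
      exact: cvg_fst.
    by apply: cvgD; [exact: cvg_snd|exact: cvg_cst].
  have -> : (x, s) = h (x, r) by rewrite /h /= addrC subrK.
  move=> U /ch /cfr [p [/= fp Up]]; exists (h p); split => //.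
  by rewrite /epi/= (le_trans fp)// lee_fin lerDl subr_ge0.
apply/seteqP; split=> [[x r] /=|[x r] cfr]; last first.
  by apply: ereal_inf_lbound; exists r.
rewrite /epi /= => xr; have /closure_id -> := @closed_closure _ (epi f).
have step (e : R) : 0 < e -> closure (epi f) (x, r + e).
  move=> e0; have : (lsc_hull f x < (r + e)%:E)%E.
    by rewrite (le_lt_trans xr)// lte_fin ltrDl.
  by move=> /ereal_inf_lt[_ [s /= cs <-]]; rewrite lte_fin => /ltW /up; apply.
move=> U [[V W] /= [Vx /nbhs_ballP[e /= e0 We]] VWU].
exists (x, r + e / 2); split; first by apply: step; rewrite divr_gt0.
apply: VWU; split; first exact: nbhs_singleton.
apply: We; rewrite /ball/= opprD addNKr normrN gtr0_norm ?divr_gt0//.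
by rewrite ltr_pdivrMr// ltr_pMr// ltr1n.
Qed.

End ConvexAnalysis.

Section SSDSpace.
Context {R : realType} {B : normedModType R}.
Variable form : {symmetric B}.
Implicit Types (A : set B) (f h : B -> \bar R).

Definition q (b : B) : R := 2^-1 * form b b.

Definition qpositive A := A !=set0 /\ forall b c, A b -> A c -> 0 <= q (b - c).

Definition max_qpositive A :=
  qpositive A /\ forall C, qpositive C -> A `<=` C -> C = A.

Definition contact f : set B := [set b | f b = (q b)%:E].

Definition conj_at f : B -> \bar R :=
  fun c => ereal_sup [set ((form b c)%:E - f b)%E | b in [set: B]].

Definition Theta A : dual B -> \bar R :=
  fun b' => ereal_sup [set (b' a - q a)%:E | a in A].

Definition star_Theta A : B -> \bar R :=
  fun c => ereal_sup [set ((b' c)%:E - Theta A b')%E | b' in [set: dual B]].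

Definition calH A : set (B -> \bar R) :=
  [set h | [/\ convex_fun h, lower_semicontinuous h,
    forall b, ((q b)%:E <= h b)%E & A `<=` contact h]].

End SSDSpace.

Section Simons.
Context {R : realType} {B : completeNormedModType R}.

(* The duality map is uniquely determined by the form; it is a parameter only
   because Phi is defined from it. *)
Record simons_space (form : {symmetric B}) (iota : {linear B -> dual B}) : Prop :=
  SimonsSpace {
    simons_nonzero : exists b : B, b != 0 ;
    simons_norm_ge0 : forall b : B, 0 <= 2^-1 * `|b| ^+ 2 + q form b ;
    simons_iota_continuous : continuous iota ;
    simons_iotaE : forall b c : B, iota c b = form b c }.

Definition Phi (form : {symmetric B}) (iota : {linear B -> dual B}) (A : set B) :
  B -> \bar R := Theta form A \o iota.

End Simons.

Section Enlargements.
Context {R : realType} {B : normedModType R}.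
Variable form : {symmetric B}.
Implicit Types (A : set B) (E : {nonneg R} -> set B).
Local Notation q := (q form).

Definition graph_mf E : set (R * B) := [set p | exists2 e, e%:num = p.1 & E e p.2].

(* As [0, +oo[ is closed in R, the closure of the graph in R * B is also its
   closure in [0, +oo[ * B. *)
Definition closure_mf E : {nonneg R} -> set B :=
  fun e => [set b | closure (graph_mf E) (e%:num, b)].

(* The existential over {nonneg R} carries the requirement that the new
   parameter be nonnegative. *)
Definition transportation_formula E :=
  forall (e1 e2 : {nonneg R}) (b1 b2 : B) (a1 a2 : R),
    E e1 b1 -> E e2 b2 -> 0 <= a1 -> 0 <= a2 -> a1 + a2 = 1 ->
    exists2 e : {nonneg R},
      e%:num = a1 * e1%:num + a2 * e2%:num + a1 * a2 * q (b1 - b2) &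
      E e (a1 *: b1 + a2 *: b2).

Definition enlargements A : set ({nonneg R} -> set B) :=
  [set E | [/\ forall e, A `<=` E e,
    forall e1 e2 : {nonneg R}, e1%:num <= e2%:num -> E e1 `<=` E e2 &
    transportation_formula E]].

Definition max_enlargement A : {nonneg R} -> set B :=
  fun e => [set b | forall c, A c -> - e%:num <= q (b - c)].

Definition min_enlargement A : {nonneg R} -> set B :=
  fun e => \bigcap_(E in enlargements A) E e.

Definition lambda E : B -> \bar R :=
  fun b => ereal_inf [set e%:num%:E | e in [set e | E e b]].

Definition Lambda E : B -> \bar R := fun b => (lambda E b + (q b)%:E)%E.

End Enlargements.

(* Main.v *)
Require Import Defs.
From HB Require Import structures.
From mathcomp Require Import all_boot all_order all_algebra sesquilinear.
From mathcomp Require Import all_classical all_reals.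
From mathcomp Require Import interval_inference ereal topology normedtype convex.
From mathcomp Require Import unstable ring lra.

Set Implicit Arguments.
Unset Strict Implicit.
Unset Printing Implicit Defensive.

Import Order.TTheory GRing.Theory Num.Theory.
Import numFieldNormedType.Exports.

Local Open Scope classical_set_scope.
Local Open Scope ring_scope.

(** The function [star_Theta form A] is the supremum of the continuous affine
    functions lying below [q] on [A], i.e. the biconjugate of [q] plus the
    indicator of [A]. Everything rests on two estimates for it.

    Below by [q] ([q_le_star_Theta]): testing the supremum that defines
    [star_Theta] with the functionals [iota a], [a] in [A], gives
    [Phi c <= star_Theta c], because [Phi] coincides with [q] on [A]; testing it
    with [iota c] gives [2 * q c - Phi c <= star_Theta c]. The larger of
    [Phi c] and [2 * q c - Phi c] is at least [q c]. Hence [star_Theta] is itself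
    a convex lower semicontinuous majorant of [q] that equals [q] on [A].

    Maximality ([calH_le_star_Theta]): every such majorant [h] is below
    [star_Theta]. Indeed [h] is the supremum of its continuous affine minorants
    ([convex_lsc_affine_minorant]), and each of these is below [q] on [A]. The
    minorants are built from the Hahn-Banach theorem, which is proved below by
    finding a minimal sublinear functional with Zorn's lemma.

    (i) is the conjunction of the two estimates. For (ii), the closed convex hull
    of [q] plus the indicator lies between [star_Theta] and that function, so it
    is another majorant and maximality forces equality.

    For (iii), a maximally [q]-positive set satisfies [q <= Phi], which makes the
    formula for the largest enlargement an unfolding of definitions. For the
    smallest one, a convex majorant [h] gives the enlargement
    [h b <= e + q b] ([calH_enlargement]): the transportation formula is exactly
    the convexity of [h], the correction term compensating for the defect of
    convexity of [q]. Applied to [star_Theta], whose epigraph is closed, this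
    bounds [Lambda] of the closure from below. Conversely the transportation
    formula for the smallest enlargement says that its [Lambda] is convex, so it
    is below the convex hull in (ii), and taking closures gives the upper bound.

    For (iv), [q <= Phi <= conj_at h] for maximal [A]; that the conjugate is at
    most [q] on [A] says that the tangent of [q] at a point of [A] is a minorant
    of [h], which follows from convexity along segments issued from that point
    ([calH_ge_affine]). *)

(** * Sublinear functionals and the Hahn-Banach theorem *)

Section HahnBanach.
Context {R : realType} {V : lmodType R}.
Implicit Types p : V -> R.

(** Positive homogeneity is asked as an inequality, which is what infima give
    directly; the equality is [sublinearZ]. *)
Definition sublinear p :=
  (forall v w, p (v + w) <= p v + p w) /\
  (forall (t : R) v, 0 <= t -> p (t *: v) <= t * p v).

Lemma sublinear0 p : sublinear p -> p 0 = 0.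
Proof.
move=> [pD pZ]; apply/eqP; rewrite eq_le; apply/andP; split.
  by have := pZ 0 0 (lexx 0); rewrite scale0r mul0r.
by have := pD 0 0; rewrite addr0; lra.
Qed.

Lemma sublinearN_ge p v : sublinear p -> - p (- v) <= p v.
Proof.
move=> sp; have := sp.1 v (- v).
by rewrite subrr sublinear0 //; lra.
Qed.

Lemma sublinearZ p (t : R) v : sublinear p -> 0 <= t -> p (t *: v) = t * p v.
Proof.
move=> sp; rewrite le_eqVlt => /predU1P[<-|t0].
  by rewrite scale0r mul0r sublinear0.
apply/eqP; rewrite eq_le sp.2 ?(ltW t0) //=.
rewrite -ler_pdivlMl //; have := sp.2 t^-1 (t *: v).
by rewrite scalerA mulVf ?gt_eqF // scale1r invr_ge0 ltW //; exact.
Qed.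

(** The three infima taken below (over a chain, along a direction, and the
    infimal convolution with the norm) are sublinear for this common reason. *)
Lemma sublinear_inf (S : V -> set R) (m : V -> R) :
  (forall v, S v !=set0) -> (forall v, lbound (S v) (m v)) ->
  (forall v w r s, S v r -> S w s -> exists2 u, S (v + w) u & u <= r + s) ->
  (forall (t : R) v r, 0 <= t -> S v r -> exists2 u, S (t *: v) u & u <= t * r) ->
  sublinear (fun v => inf (S v)).
Proof.
move=> S0 Sm SD SZ.
have hS v : has_inf (S v) by split; [exact: S0|exists (m v); exact: Sm].
have infS v r : S v r -> inf (S v) <= r by apply: ge_inf; exact: (hS v).2.
split=> [v w|t v t0].
  rewrite -inf_sumE //; apply: lb_le_inf.
    have [[r Sr] [s Ss]] := (S0 v, S0 w).
    by exists (r + s); exists r => //; exists s.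
  move=> _ [r Sr [s Ss <-]]; have [u Su urs] := SD _ _ _ _ Sr Ss.
  exact: le_trans (infS _ _ Su) urs.
move: t0; rewrite le_eqVlt => /predU1P[<-|t0].
  have [r Sr] := S0 v; have [u Su] := SZ 0 v r (lexx 0) Sr.
  by rewrite !mul0r; exact: le_trans (infS _ _ Su).
rewrite -ler_pdivrMl //; apply: lb_le_inf => // r Sr.
rewrite ler_pdivrMl //; have [u Su ur] := SZ _ _ _ (ltW t0) Sr.
exact: le_trans (infS _ _ Su) ur.
Qed.

(** Pushing [p] along a direction [x], that is replacing [p w] by the infimum
    over [t >= 0] of [p (w + t *: x) - t * p x], gives a sublinear functional
    below [p]. Minimality makes it equal to [p], and [t = 1] then yields the
    superadditivity of [p]. *)
Lemma minimal_sublinear_linear p : sublinear p ->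
  (forall p', sublinear p' -> (forall v, p' v <= p v) -> p' = p) ->
  linear (p : V -> R^o).
Proof.
move=> sp pmin.
have pD x v : p (v + x) = p v + p x.
  pose S (w : V) : set R := [set p (w + t *: x) - t * p x | t in [set t | 0 <= t]].
  have Sm w : lbound (S w) (- p (- w)).
    move=> _ [t /= t0 <-]; have := sp.1 (w + t *: x) (- w).
    by rewrite [w + _]addrC addrK sublinearZ //; lra.
  have S0 w : S w (p w) by exists 0 => //=; rewrite scale0r addr0 mul0r subr0.
  have infS w r : S w r -> inf (S w) <= r.
    by apply: ge_inf; exists (- p (- w)); exact: Sm.
  have pE : (fun w => inf (S w)) = p.
    apply: pmin => [|w]; last exact: infS.
    apply: sublinear_inf Sm _ _ => [w|w1 w2 _ _ [t1 /= t10 <-] [t2 /= t20 <-]|].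
    - by exists (p w).
    - exists (p (w1 + w2 + (t1 + t2) *: x) - (t1 + t2) * p x).
        by exists (t1 + t2) => //=; exact: addr_ge0.
      by rewrite scalerDl addrACA; have := sp.1 (w1 + t1 *: x) (w2 + t2 *: x); lra.
    - move=> t w _ t0 [s /= s0 <-].
      exists (p (t *: w + (t * s) *: x) - t * s * p x).
        by exists (t * s) => //=; exact: mulr_ge0.
      by rewrite -scalerA -scalerDr sublinearZ // mulrBr mulrA.
  apply/eqP; rewrite eq_le sp.1 /=.
  have : inf (S v) <= p (v + 1 *: x) - 1 * p x by apply: infS; exists 1 => //=.
  by have /(congr1 (@^~ v)) /= -> := pE; rewrite scale1r mul1r; lra.
move=> a v w; rewrite pD; congr (_ + _).
have [a0|a0] := leP 0 a; first exact: sublinearZ.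
have pN u : p (- u) = - p u.
  by have := pD (- u) u; rewrite subrr sublinear0 //; lra.
rewrite -[a *: v]opprK -scaleNr pN sublinearZ ?oppr_ge0 ?ltW //.
by rewrite mulNr opprK.
Qed.

(** Sublinear functionals below [p] are bounded below by [- p (- v)], so that
    chains have infima and Zorn's lemma gives a minimal one. *)
Theorem Hahn_Banach p : sublinear p ->
  exists2 l : V -> R^o, linear l & forall v, l v <= p v.
Proof.
move=> sp.
pose T := {f : V -> R | sublinear f /\ forall v, f v <= p v}.
pose Rel (f g : T) := `[< forall v, sval g v <= sval f v >].
have [| | | |m mmin] := @Zorn T Rel.
- by move=> f; apply/asboolP => v; exact: lexx.
- move=> f g h /asboolP fg /asboolP gh; apply/asboolP => v.
  by have := gh v; have := fg v; lra.
- move=> [f ?] [g ?] /asboolP /= gf /asboolP /= fg; apply/eq_exist/funext => v.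
  by apply/eqP; rewrite eq_le fg gf.
- move=> C Ctot; have [->|/set0P[f0 Cf0]] := eqVneq C set0.
    by exists (exist _ p (conj sp (fun v => lexx _))) => ? [].
  pose S (v : V) : set R := [set sval f v | f in C].
  have Sm v : lbound (S v) (- p (- v)).
    move=> _ [f Cf <-]; have := sublinearN_ge v (svalP f).1.
    by have := (svalP f).2 (- v); lra.
  have infS f v : C f -> inf (S v) <= sval f v.
    by move=> Cf; apply: ge_inf; [exists (- p (- v)); exact: Sm|exists f].
  have sinf : sublinear (fun v => inf (S v)).
    apply: sublinear_inf Sm _ _ => [v|v w _ _ [f Cf <-] [g Cg <-]|].
    - by exists (sval f0 v); exists f0.
    - have [/asboolP gf|/asboolP fg] := Ctot _ _ Cf Cg.
        exists (sval g (v + w)); first by exists g.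
        by have := (svalP g).1.1 v w; have := gf v; lra.
      exists (sval f (v + w)); first by exists f.
      by have := (svalP f).1.1 v w; have := fg w; lra.
    - move=> t v _ t0 [f Cf <-]; exists (sval f (t *: v)); first by exists f.
      exact: (svalP f).1.2.
  have infp v : inf (S v) <= p v.
    by have := infS _ v Cf0; have := (svalP f0).2 v; lra.
  exists (exist _ (fun v => inf (S v)) (conj sinf infp)) => f Cf; apply/asboolP => v /=.
  exact: infS.
exists (sval m); last exact: (svalP m).2.
apply: minimal_sublinear_linear (svalP m).1 _ => f sf fm.
have fp v : f v <= p v by exact: le_trans (fm v) ((svalP m).2 v).
by rewrite -(mmin (exist _ f (conj sf fp))) //; apply/asboolP.
Qed.
End HahnBanach.

(** * Affine minorants of convex functions *)

Section AffineMinorant.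
Context {R : realType} {B : normedModType R}.
Implicit Types (f h : B -> \bar R) (x y : B).

Lemma convex_funP f : convex_fun f <->
  forall x y (r s a b : R), (f x <= r%:E)%E -> (f y <= s%:E)%E ->
    0 <= a -> 0 <= b -> a + b = 1 ->
    (f (a *: x + b *: y)%R <= (a * r + b * s)%:E)%E.
Proof.
split=> [cf x y r s a b fx fy a0 b0 ab|cf [x r] [y s] t].
  have a1 : a <= 1 by lra.
  have := cf (x, r) (y, s) (Itv01 a0 a1); rewrite !inE => /(_ fx fy).
  by rewrite /epi /conv /= /onem -ab addrAC subrr add0r.
rewrite !inE /epi /= => fx fy.
by apply: cf fx fy _ _ _; rewrite ?add_onemK // onem_ge0.
Qed.

(** The infimal convolution of the norm [M * `|v|] with the sublinear functional
    generated by [y - x |-> h y - al] is finite because the cone [- M * `|v|]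
    lies below both. A linear functional below it is bounded by [M] and, taking
    [t = 1], is below [h y - al] at [y - x]. *)
Lemma convex_affine_minorant h x (al M : R) : convex_fun h -> epi h !=set0 ->
  0 <= M -> (forall y r, (h y <= r%:E)%E -> al - M * `|y - x| <= r) ->
  exists l : dual B, forall y r, (h y <= r%:E)%E -> al + l (y - x) <= r.
Proof.
move=> /convex_funP ch [[y0 r0] /= h0] M0 hM.
pose S (v : B) : set R := [set s | exists t y r, [/\ 0 <= t, (h y <= r%:E)%E &
  s = t * (r - al) + M * `|v - t *: (y - x)| ] ].
have Sm v : lbound (S v) (- (M * `|v|)).
  move=> _ [t [y [r [t0 yr ->]]]].
  have : t * - (M * `|y - x|) <= t * (r - al).
    by rewrite ler_wpM2l //; have := hM _ _ yr; lra.
  have : M * (t * `|y - x|) <= M * (`|v - t *: (y - x)| + `|v|).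
    rewrite ler_wpM2l //.
    have -> : t * `|y - x| = `|t *: (y - x)| by rewrite normrZ ger0_norm.
    rewrite -[X in `|X| <= _](subKr v); have := ler_normB v (v - t *: (y - x)).
    by rewrite [X in _ <= X]addrC.
  by lra.
have S0 v : S v (M * `|v|).
  by exists 0, y0, r0; split=> //; rewrite mul0r scale0r subr0 add0r.
have [|l linl lS] := @Hahn_Banach _ _ (fun v => inf (S v)).
  apply: sublinear_inf Sm _ _ => [v|v w _ _ [t [y [r [t0 yr ->]]]] [t' [y' [r' [t'0 yr' ->]]]]|].
  - by exists (M * `|v|).
  - have [t0'|tt'] := eqVneq (t + t') 0.
      have [tz t'z] : t = 0 /\ t' = 0 by split; lra.
      exists (M * `|v + w|) => //; rewrite tz t'z !scale0r !mul0r !subr0 !add0r.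
      by rewrite -mulrDr ler_wpM2l // ler_normD.
    have T0 : 0 < t + t' by rewrite lt_def tt' addr_ge0.
    pose a := t / (t + t'); pose b := t' / (t + t').
    have aT : (t + t') * a = t by rewrite /a mulrC divfK.
    have bT : (t + t') * b = t' by rewrite /b mulrC divfK.
    have ab : a + b = 1 by rewrite /a /b -mulrDl divff.
    have a0 : 0 <= a by rewrite divr_ge0 // ltW.
    have b0 : 0 <= b by rewrite divr_ge0 // ltW.
    eexists.
      exists (t + t'), (a *: y + b *: y'), (a * r + b * r').
      split=> //; first exact: ltW.
      exact: ch.
    have -> : (t + t') *: (a *: y + b *: y' - x) = t *: (y - x) + t' *: (y' - x).
      rewrite !scalerBr scalerDr !scalerA aT bT scalerDl opprD.
      by rewrite addrACA.
    have -> : (t + t') * (a * r + b * r' - al) = t * (r - al) + t' * (r' - al).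
      transitivity ((t + t') * a * r + (t + t') * b * r' - (t + t') * al).
        by ring.
      by rewrite aT bT; ring.
    have : M * `|v + w - (t *: (y - x) + t' *: (y' - x))| <=
           M * (`|v - t *: (y - x)| + `|w - t' *: (y' - x)|).
      by rewrite ler_wpM2l // opprD addrACA ler_normD.
    by lra.
  - move=> s v _ s0 [t [y [r [t0 yr ->]]]].
    exists (s * t * (r - al) + M * `|s *: v - (s * t) *: (y - x)|).
      by exists (s * t), y, r; split=> //; exact: mulr_ge0.
    by rewrite -scalerA -scalerBr normrZ ger0_norm //; lra.
have infS v r : S v r -> inf (S v) <= r.
  by apply: ge_inf; exists (- (M * `|v|)); exact: Sm.
pose L : {linear B -> R^o} := HB.pack l (GRing.isLinear.Build R B R^o _ l linl).
have lM v : `|l v| <= M * `|v|.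
  have lM' u : l u <= M * `|u| by apply: le_trans (lS u) (infS _ _ (S0 u)).
  rewrite ler_norml lM' andbT; have := lM' (- v).
  by rewrite normrN (linearN L v : l (- v) = - l v); lra.
have cl : continuous l.
  apply: (@linear_bounded_continuous _ _ _ L).1.
  apply/linear_boundedP; exists M; split => [|r Mr v]; first exact: num_real.
  by apply: le_trans (lM v) _; rewrite ler_wpM2r // ltW.
have ld : l \in is_dual by rewrite inE.
exists (Dual ld) => y r yr /=.
have : l (y - x) <= 1 * (r - al) + M * `|(y - x) - 1 *: (y - x)|.
  by apply: le_trans (lS _) (infS _ _ _); exists 1, y, r; split.
by rewrite scale1r subrr normr0; lra.
Qed.
End AffineMinorant.

Section LscMinorant.
Context {R : realType} {B : normedModType R}.
Implicit Types (f h : B -> \bar R) (x y : B).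

Lemma lower_semicontinuous_ball h x (al : R) :
  lower_semicontinuous h -> (al%:E < h x)%E ->
  exists2 d : R, 0 < d & forall y r, `|y - x| < d -> (h y <= r%:E)%E -> al < r.
Proof.
move=> hl /hl[V /nbhs_ballP[d /= d0 dV] Val]; exists d => // y r yd yr.
rewrite -lte_fin; apply: lt_le_trans yr; apply/Val/dV.
by rewrite -ball_normE /= distrC.
Qed.

(** Near [y0] the bound comes from lower semicontinuity. A far away [y] is pulled
    back along the segment from [y0] into the ball where that bound holds, and
    convexity transfers it with a linear loss. *)
Lemma convex_lsc_bounded_slope h y0 (r0 : R) :
  convex_fun h -> lower_semicontinuous h -> h y0 = r0%:E ->
  exists2 M : R, 0 <= M & forall y r, (h y <= r%:E)%E ->
    r0 - 1 - M * `|y - y0| <= r.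
Proof.
move=> /convex_funP ch hl h0.
have [|d d0 hd] := @lower_semicontinuous_ball _ y0 (r0 - 1) hl.
  by rewrite h0 lte_fin; lra.
exists (2 / d) => [|y r yr]; first by rewrite divr_ge0 // ltW.
have [/hd/(_ yr)|dy] := ltP `|y - y0| d.
  have : 0 <= 2 / d * `|y - y0| by rewrite !mulr_ge0 ?invr_ge0 // ltW.
  by lra.
set n := `|y - y0| in dy *; have n0 : 0 < n by exact: lt_le_trans dy.
(* The point at distance [d / 2] from [y0] on the segment to [y]. *)
pose t := d / 2 / n.
have t0 : 0 < t by rewrite !divr_gt0.
have t1 : t <= 1 by rewrite ler_pdivrMr // mul1r; lra.
have h0' : (h y0 <= r0%:E)%E by rewrite h0.
have := ch _ _ _ _ (1 - t) t h0' yr.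
rewrite subr_ge0 t1 subrK => /(_ isT (ltW t0) erefl) /hd.
have -> : (1 - t) *: y0 + t *: y - y0 = t *: (y - y0).
  by rewrite scalerBl scale1r scalerBr addrC addrA addrA addNr add0r addrC.
rewrite normrZ gtr0_norm // -/n.
have tn : t * n = d / 2 by rewrite divfK // gt_eqF.
rewrite tn => /(_ (ltac:(lra))) rt.
have nt : n / (d / 2) * t = 1 by rewrite mulrC -tn; field; rewrite !gt_eqF.
have nd0 : 0 < n / (d / 2) by rewrite !divr_gt0.
have : 0 < n / (d / 2) * (1 + t * (r - r0)) by rewrite mulr_gt0 //; lra.
rewrite mulrDr mulr1 [_ * (t * _)]mulrA nt mul1r.
have -> : 2 / d * n = n / (d / 2) by field; rewrite gt_eqF.
by lra.
Qed.

(** A cone with vertex [(x, al)] lies below [h]: within the radius [d] because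
    [al < h], beyond it because the slope found at [y0] can be increased by
    [`|al - c| / d]. Passing through [y0] covers the case where [h x] is
    infinite. *)
Lemma convex_lsc_affine_minorant h x y0 (r0 al : R) :
  convex_fun h -> lower_semicontinuous h -> h y0 = r0%:E -> (al%:E < h x)%E ->
  exists l : dual B, forall y r, (h y <= r%:E)%E -> al + l (y - x) <= r.
Proof.
move=> ch hl h0 alx.
have [M0 M00 hM0] := convex_lsc_bounded_slope ch hl h0.
have [d d0 hd] := lower_semicontinuous_ball hl alx.
pose c := r0 - 1 - M0 * `|x - y0|.
have hc y r : (h y <= r%:E)%E -> c - M0 * `|y - x| <= r.
  move=> /hM0; have : M0 * `|y - y0| <= M0 * (`|y - x| + `|x - y0|).
    by rewrite ler_wpM2l // ler_distD.
  by rewrite /c; lra.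
have k0 : 0 <= `|al - c| / d by rewrite divr_ge0 // ltW.
apply: (@convex_affine_minorant _ _ h x al (M0 + `|al - c| / d)) => //.
- by exists (y0, r0); rewrite /epi /= h0.
- by apply: addr_ge0.
- move=> y r yr; have [/hd/(_ yr)|dy] := ltP `|y - x| d.
    have : 0 <= (M0 + `|al - c| / d) * `|y - x| by rewrite mulr_ge0 // addr_ge0.
    by lra.
  have : `|al - c| / d * d <= `|al - c| / d * `|y - x| by rewrite ler_wpM2l.
  by rewrite divfK ?gt_eqF //; have := hc _ _ yr; have := ler_norm (al - c); lra.
Qed.
End LscMinorant.

(** * Lower semicontinuity, hulls and suprema of affine functions *)

Section ClosureLsc.
Context {R : realType} {B : normedModType R}.
Implicit Types (f h : B -> \bar R) (x y : B).

Lemma closure_continuous_image (X Y : topologicalType) (g : X -> Y)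
    (P : set X) (Q : set Y) (z : X) :
  {for z, continuous g} -> g @` P `<=` Q -> closure P z -> closure Q (g z).
Proof.
move=> cg PQ clP U /cg /clP[p [Pp Up]]; exists (g p); split => //.
by apply: PQ; exists p.
Qed.

Lemma convex_set_closure (M : normedModType R) (A : set M) :
  @convex_set R M A -> @convex_set R M (closure A).
Proof.
move=> cA x y t; rewrite !inE => clx cly U.
pose g (p : M * M) : M := t%:num *: p.1 + t%:num.~ *: p.2.
have cg : {for (x, y), continuous g}.
  apply: cvgD; apply: cvgZl_tmp; [exact: cvg_fst|exact: cvg_snd].
move=> /cg[[V W] /= [Vx Wy] VWU].
have [x' [Ax' Vx']] := clx _ Vx; have [y' [Ay' Wy']] := cly _ Wy.
exists (g (x', y')); split; last exact: (VWU (x', y')).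
by have := cA x' y' t (mem_set Ax') (mem_set Ay'); rewrite inE.
Qed.

Lemma ereal_lt_dense_real (u v : \bar R) : (u < v)%E -> u != -oo%E ->
  exists2 al : R, (u < al%:E)%E & (al%:E < v)%E.
Proof.
case: u => [s| |] // + _; case: v => [t| |] // uv.
  rewrite lte_fin in uv; exists ((s + t) / 2); rewrite lte_fin; lra.
by exists (s + 1); rewrite ?ltry // lte_fin ltrDl.
Qed.

Lemma lower_semicontinuous_closure_epi h x (r : R) : lower_semicontinuous h ->
  closure (epi h) (x, r) -> (h x <= r%:E)%E.
Proof.
move=> hl cl; rewrite leNgt; apply/negP => rh.
have [al ral /hl[V Vx Val]] := ereal_lt_dense_real rh isT.
have [|[y s] [/= hys [/= Vy sal]]] := cl (V `*` [set s | s < al]).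
  exists (V, [set s | s < al]) => //; split => //.
  by apply: open_nbhs_nbhs; split; [exact: open_lt|rewrite /= -lte_fin].
have := lt_le_trans (Val _ Vy) hys.
by rewrite lte_fin ltNge ltW.
Qed.

Lemma lsc_hull_lower_semicontinuous f : lower_semicontinuous (lsc_hull f).
Proof.
move=> x al alx.
have : nbhs (x, al) (~` closure (epi f)).
  apply: open_nbhs_nbhs; split; first exact/closed_openC/closed_closure.
  by rewrite -epi_lsc_hull /epi /=; apply/negP; rewrite -ltNge.
move=> [[V W] /= [Vx Wal] VW]; exists V => // y Vy.
have := VW (y, al) (conj Vy (nbhs_singleton Wal)).
by rewrite -epi_lsc_hull /epi /= => /negP; rewrite -ltNge.
Qed.

Lemma lsc_hull_convex f : convex_fun f -> convex_fun (lsc_hull f).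
Proof. by rewrite /convex_fun epi_lsc_hull => /convex_set_closure. Qed.

Lemma lsc_hull_le f x : (lsc_hull f x <= f x)%E.
Proof.
have H (r : R) : (f x <= r%:E)%E -> (lsc_hull f x <= r%:E)%E.
  move=> fr; suff : epi (lsc_hull f) (x, r) by [].
  by rewrite epi_lsc_hull; exact: subset_closure.
case E : (f x) => [r| |]; first by apply: H; rewrite E.
  by rewrite leey.
by rewrite leeNy_eq; apply/eqP/eq_ninfty => r; apply: H; rewrite E leNye.
Qed.

Lemma le_lsc_hull f h x : lower_semicontinuous h -> (forall y, (h y <= f y)%E) ->
  (h x <= lsc_hull f x)%E.
Proof.
move=> hl hf; apply: le_ereal_inf_tmp => _ [r cl <-].
apply: lower_semicontinuous_closure_epi hl _.
apply: closureS cl => -[y s] /=; rewrite /epi /=.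
exact: le_trans.
Qed.

Lemma sup_affine_convex (I : Type) (l : I -> dual B) (g : I -> \bar R) :
  convex_fun (fun x => ereal_sup [set ((l i x)%:E - g i)%E | i in [set: I]]).
Proof.
apply/convex_funP => x y r s a b xr ys a0 b0 ab.
apply: ge_ereal_sup => _ [i _ <-].
have : ((l i x)%:E - g i <= r%:E)%E.
  by apply: le_trans xr; apply: ereal_sup_ubound; exists i.
have : ((l i y)%:E - g i <= s%:E)%E.
  by apply: le_trans ys; apply: ereal_sup_ubound; exists i.
case: (g i) => [t| |]; last 2 first.
- by rewrite /= !leNye.
- by rewrite /= leye_eq.
rewrite -!EFinB !lee_fin => ly lx.
rewrite linearD !linearZ /=.
have : a * (l i x - t) <= a * r by rewrite ler_wpM2l.
have : b * (l i y - t) <= b * s by rewrite ler_wpM2l.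
have : a * t + b * t = t by rewrite -mulrDl ab mul1r.
rewrite /GRing.scale /=; lra.
Qed.

Lemma sup_affine_lsc (I : Type) (l : I -> dual B) (g : I -> \bar R) :
  lower_semicontinuous
    (fun x => ereal_sup [set ((l i x)%:E - g i)%E | i in [set: I]]).
Proof.
move=> x al /ereal_sup_gt[_ [i _ <-]] ali.
suff [V Vx Val] : exists2 V, nbhs x V & forall y, V y -> (al%:E < (l i y)%:E - g i)%E.
  exists V => // y /Val /lt_le_trans; apply; apply: ereal_sup_ubound.
  by exists i.
case: (g i) ali => [t| |] //= ali; last first.
  by exists setT => [|y _]; [exact: filterT|rewrite ltry].
exists [set y | al + t < l i y].
  apply: (@dual_continuous _ _ (l i) x [set z : R^o | al + t < z]).
  apply: open_nbhs_nbhs; split; first exact: open_gt.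
  by move: ali; rewrite -EFinB lte_fin /=; lra.
by move=> y /=; rewrite -EFinB lte_fin; lra.
Qed.
End ClosureLsc.

(** * The quadratic form of an SSD space *)

Section QuadraticForm.
Context {R : realType} {B : normedModType R} (form : {symmetric B}).
Local Notation q := (q form).
Implicit Types (a b c : B).

Lemma form_sym b c : form b c = form c b.
Proof. by rewrite hermC /= expr0 mul1r. Qed.

Lemma qN b : q (- b) = q b.
Proof. by rewrite /Defs.q linearNl linearNr opprK. Qed.

Lemma qB b c : q (b - c) = q b + q c - form b c.
Proof.
rewrite /Defs.q linearBl !linearBr /= (form_sym c b); lra.
Qed.

Lemma q0 : q 0 = 0.
Proof. by rewrite /Defs.q linear0l mulr0. Qed.

(** The defect of convexity of [q] is the correction term of the transportation
    formula, which is why convex majorants of [q] correspond to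
    enlargements. *)
Lemma q_conv (s t : R) b c : s + t = 1 ->
  q (s *: b + t *: c) = s * q b + t * q c - s * t * q (b - c).
Proof.
move=> st; rewrite qB /Defs.q linearDl !linearDr /= !linearZl_LR !linearZr_LR /=.
rewrite (form_sym c b) /GRing.scale /=.
have -> : s = 1 - t by lra.
by field; rewrite ?pnatr_eq0.
Qed.
End QuadraticForm.

Section Conjugates.
Context {R : realType} {B : completeNormedModType R}.
Variables (form : {symmetric B}) (iota : {linear B -> dual B}).
Hypothesis simonsB : simons_space form iota.
Local Notation q := (q form).
Implicit Types (A : set B) (h : B -> \bar R) (b c : B).

Lemma form_continuous c : continuous (form^~ c : B -> R^o).
Proof.
have -> : form^~ c = iota c by apply/funext => b; rewrite (simons_iotaE simonsB).
exact: dual_continuous.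
Qed.

(** For [b] in the unit ball, [`|q b|] is at most half the norm of [iota b]. *)
Lemma q_continuous0 : {for 0, continuous (q : B -> R^o)}.
Proof.
apply/cvgrPdist_le => e e0.
have /cvgrPdist_le /(_ e e0) := simons_iota_continuous simonsB (x := 0).
rewrite linear0 q0 => ie; near=> b.
rewrite sub0r normrN /Defs.q normrM -(simons_iotaE simonsB).
have b1 : `|b| <= 1.
  by near: b; apply: nbhs0_le.
have : `|iota b b| <= e.
  apply: le_trans (dual_norm_ub _ b1) _.
  have : `|0 - iota b| <= e by near: b.
  by rewrite sub0r normrN.
have -> : `|2^-1 : R| = 2^-1 by rewrite ger0_norm.
by have := normr_ge0 (iota b b); lra.
Unshelve. all: by end_near.
Qed.

Lemma q_continuous : continuous (q : B -> R^o).
Proof.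
move=> c.
have qE : (q : B -> R^o) = (fun b => (q c - form c c) + form b c + q (b - c)).
  by apply/funext => b; rewrite qB /Defs.q; lra.
suff : (fun b => (q c - form c c) + form b c + q (b - c) : R^o) x @[x --> c] -->
    ((q c - form c c) + form c c + 0 : R^o) by rewrite subrK addr0 -qE.
apply: cvgD; first by apply: cvgD; [exact: cvg_cst|exact: form_continuous].
rewrite -(q0 form).
apply: (@cvg_comp _ _ _ (fun b => b - c) q _ (nbhs (0 : B))); last exact: q_continuous0.
rewrite -(subrr c).
by apply: cvgB; [exact: cvg_id|exact: cvg_cst].
Qed.

End Conjugates.

(** * The largest convex representative *)

Section StarTheta.
Context {R : realType} {B : normedModType R} (form : {symmetric B}).
Local Notation q := (q form).
Implicit Types (A : set B) (h : B -> \bar R) (b c : B) (l : dual B).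

Lemma Theta_ge A a l : A a -> ((l a - q a)%:E <= Theta form A l)%E.
Proof. by move=> Aa; apply: ereal_sup_ubound; exists a. Qed.

Lemma star_Theta_le_q A a : A a -> (star_Theta form A a <= (q a)%:E)%E.
Proof.
move=> Aa; apply: ge_ereal_sup => _ [l _ <-].
have := Theta_ge l Aa; case: (Theta form A l) => [t| |].
- by rewrite -EFinB !lee_fin; lra.
- by rewrite /= leNye.
- by rewrite leeNy_eq.
Qed.

Lemma star_Theta_convex A : convex_fun (star_Theta form A).
Proof. exact: (@sup_affine_convex _ _ (dual B) id). Qed.

Lemma star_Theta_lsc A : lower_semicontinuous (star_Theta form A).
Proof. exact: (@sup_affine_lsc _ _ (dual B) id). Qed.

Lemma star_Theta_ge_affine A x l (al : R) :
  (forall a, A a -> al + l (a - x) <= q a) -> (al%:E <= star_Theta form A x)%E.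
Proof.
move=> lA; apply: le_trans (ereal_sup_ubound _); last by exists l.
have : (Theta form A l <= (l x - al)%:E)%E.
  apply: ge_ereal_sup => _ [a Aa <-]; rewrite lee_fin.
  by have := lA _ Aa; rewrite linearB /=; lra.
case: (Theta form A l) => [t| |].
- by rewrite -EFinB !lee_fin; lra.
- by rewrite leye_eq.
- by rewrite leey.
Qed.

(** Affine minorants of [h] are below [q] on [A], hence take part in the
    supremum defining [star_Theta]; they suffice to recover [h]. *)
Lemma calH_le_star_Theta A h : A !=set0 -> calH form A h ->
  forall x, (h x <= star_Theta form A x)%E.
Proof.
move=> [a0 Aa0] [ch hl hq hA] x; rewrite leNgt; apply/negP => sh.
have Aq a : A a -> (h a <= (q a)%:E)%E by move=> /hA ->.
have below (al : R) : (al%:E < h x)%E -> (al%:E <= star_Theta form A x)%E.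
  move=> alh; have [l hl'] := convex_lsc_affine_minorant ch hl (hA _ Aa0) alh.
  by apply: (star_Theta_ge_affine (l := l)) => a Aa; apply: hl' (Aq _ Aa).
have sNy : star_Theta form A x != -oo%E.
  (* [al] can be any real below [h x], and [q x - 1] is one. *)
  have /lt_le_trans /(_ (hq x)) /below : ((q x - 1)%:E < (q x)%:E)%E.
    by rewrite lte_fin; lra.
  by apply: contraTneq => ->.
have [al sal /below] := ereal_lt_dense_real sh sNy.
by rewrite leNgt sal.
Qed.

Lemma calH_star_Theta_eq A h : A !=set0 -> calH form A h ->
  (forall x, (star_Theta form A x <= h x)%E) -> h = star_Theta form A.
Proof.
by move=> A0 hA sh; apply/funext => x; apply/eqP; rewrite eq_le sh calH_le_star_Theta.
Qed.

End StarTheta.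

Section StarThetaSimons.
Context {R : realType} {B : completeNormedModType R}.
Variables (form : {symmetric B}) (iota : {linear B -> dual B}).
Hypothesis simonsB : simons_space form iota.
Local Notation q := (q form).
Implicit Types (A : set B) (h : B -> \bar R) (b c : B).

Lemma Phi_ge A a c : A a -> ((form a c - q a)%:E <= Phi form iota A c)%E.
Proof.
by move=> Aa; rewrite -(simons_iotaE simonsB); exact: Theta_ge.
Qed.

Lemma Phi_le A c (r : R) : (forall a, A a -> form a c - q a <= r) ->
  (Phi form iota A c <= r%:E)%E.
Proof.
move=> Ar; apply: ge_ereal_sup => _ [a Aa <-].
by rewrite (simons_iotaE simonsB) lee_fin Ar.
Qed.

Lemma Phi_le_q A a : qpositive form A -> A a -> (Phi form iota A a <= (q a)%:E)%E.
Proof.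
move=> [_ qA] Aa; apply: Phi_le => b Ab.
by have := qA _ _ Ab Aa; rewrite qB; lra.
Qed.

Lemma star_Theta_ge_conj A c b (p : R) : (Phi form iota A b <= p%:E)%E ->
  ((form c b - p)%:E <= star_Theta form A c)%E.
Proof.
move=> bp; apply: (star_Theta_ge_affine (l := iota b)) => a Aa.
have := le_trans (Phi_ge b Aa) bp.
by rewrite lee_fin !(simons_iotaE simonsB) linearBl /=; lra.
Qed.

Lemma Phi_le_star_Theta A c : qpositive form A ->
  (Phi form iota A c <= star_Theta form A c)%E.
Proof.
move=> qA; apply: ge_ereal_sup => _ [a Aa <-].
rewrite (simons_iotaE simonsB) (form_sym form a c).
exact/star_Theta_ge_conj/Phi_le_q.
Qed.

(** Both [Phi c] and [2 * q c - Phi c] are lower bounds, and their mean is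
    [q c]; when [Phi c] is infinite the first one suffices. *)
Lemma q_le_star_Theta A c : qpositive form A ->
  ((q c)%:E <= star_Theta form A c)%E.
Proof.
move=> qA; have := Phi_le_star_Theta c qA.
have [a Aa] := qA.1; have := Phi_ge c Aa.
case E : (Phi form iota A c) => [p| |] // _ ps; last first.
  by apply: le_trans ps; rewrite leey.
have [qp|pq] := leP (q c) p; first by apply: le_trans ps; rewrite lee_fin.
apply: le_trans (star_Theta_ge_conj c (b := c) (p := p) _); last by rewrite E.
have -> : form c c = 2 * q c by rewrite /Defs.q mulVKf.
by rewrite lee_fin; lra.
Qed.

Lemma star_Theta_calH A : qpositive form A -> calH form A (star_Theta form A).
Proof.
move=> qA; split; [exact: star_Theta_convex|exact: star_Theta_lsc| |].
  by move=> b; exact: q_le_star_Theta.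
move=> a Aa; apply/eqP; rewrite eq_le star_Theta_le_q //=.
exact: q_le_star_Theta.
Qed.

Lemma star_Theta_le_indicator A b :
  (star_Theta form A b <= (q b)%:E + indicator A b)%E.
Proof.
rewrite /indicator; case: ifPn => [|_]; last by rewrite addey ?leey.
by rewrite inE adde0 => Ab; exact: star_Theta_le_q.
Qed.

Lemma star_Theta_sup A : qpositive form A -> star_Theta form A = pointwise_sup
  [set h : B -> \bar R | [/\ proper_fun h, convex_fun h,
     lower_semicontinuous h, (forall b, ((q b)%:E <= h b)%E) &
     A `<=` contact form h]].
Proof.
move=> qA; apply/funext => x; apply/eqP; rewrite eq_le; apply/andP; split.
  apply: ereal_sup_ubound; exists (star_Theta form A) => //.
  have [cs ls qs As] := star_Theta_calH qA; split=> //; split=> [y|].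
    by rewrite -ltNye; apply: lt_le_trans (qs y); rewrite ltNyr.
  by have [a Aa] := qA.1; exists a; rewrite (As _ Aa).
apply: ge_ereal_sup => _ [h [_ ch lh qh Ah] <-].
by apply: calH_le_star_Theta; [exact: qA.1|split].
Qed.

(** The hull is a majorant of [q] since it dominates [star_Theta], so it belongs
    to the family in which [star_Theta] is the largest. *)
Lemma star_Theta_hull A : qpositive form A -> star_Theta form A =
  lsc_hull (convex_hull (fun b => ((q b)%:E + indicator A b)%E)).
Proof.
move=> qA; set f := fun b => _; apply/esym.
have sle x : (star_Theta form A x <= lsc_hull (convex_hull f) x)%E.
  apply: le_lsc_hull => [|y]; first exact: star_Theta_lsc.
  apply: convex_hull_max => [|z]; [exact: star_Theta_convex|].
  exact: star_Theta_le_indicator.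
apply: calH_star_Theta_eq => //; first exact: qA.1.
split.
- by apply: lsc_hull_convex; exact: convex_hull_convex.
- exact: lsc_hull_lower_semicontinuous.
- by move=> b; apply: le_trans (sle b); exact: q_le_star_Theta.
move=> a Aa; apply/eqP; rewrite eq_le; apply/andP; split.
  apply: le_trans (lsc_hull_le _ _) _; apply: le_trans (convex_hull_le _ _) _.
  by rewrite /f /indicator mem_set // adde0.
by apply: le_trans (sle a); exact: q_le_star_Theta.
Qed.
End StarThetaSimons.

(** * Enlargements of maximally q-positive sets *)

Section LambdaBounds.
Context {R : realType} {B : normedModType R} (form : {symmetric B}).
Local Notation q := (q form).
Implicit Types (E : {nonneg R} -> set B) (b : B).

Lemma Lambda_ge E b (u : \bar R) :
  (forall e, E e b -> (u <= (e%:num + q b)%:E)%E) -> (u <= Lambda form E b)%E.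
Proof.
move=> uE; rewrite /Lambda -leeBlDr //; apply: le_ereal_inf_tmp => _ [e Eeb <-].
by rewrite leeBlDr // -EFinD uE.
Qed.

Lemma Lambda_le E b e : E e b -> (Lambda form E b <= (e%:num + q b)%:E)%E.
Proof.
by move=> Eeb; rewrite /Lambda EFinD leeD2r //; apply: ereal_inf_lbound; exists e.
Qed.

Lemma Lambda_lt E b (r : R) : (Lambda form E b < r%:E)%E ->
  exists2 e, E e b & e%:num + q b < r.
Proof.
rewrite /Lambda -lteBrDr // => /ereal_inf_lt[_ [e Eeb <-]].
by rewrite -EFinB lte_fin => er; exists e => //; lra.
Qed.
End LambdaBounds.

Section MaximallyPositive.
Context {R : realType} {B : completeNormedModType R}.
Variables (form : {symmetric B}) (iota : {linear B -> dual B}).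
Hypothesis simonsB : simons_space form iota.
Local Notation q := (q form).
Implicit Types (A : set B) (h : B -> \bar R) (b c : B).

Lemma max_qpositive_mem A b : max_qpositive form A ->
  (forall c, A c -> 0 <= q (b - c)) -> A b.
Proof.
move=> [[A0 qA] maxA] bA; rewrite -(maxA (A `|` [set b])); first by right.
- split; first by exists b; right.
  move=> x y [Ax|->] [Ay|->]; [exact: qA| |exact: bA|by rewrite subrr q0].
  by rewrite -qN opprB bA.
- by move=> x; left.
Qed.

(** A point outside [A] is not [q]-positively related to some [c] in [A], and
    [form c b - q c = q b - q (b - c)] then exceeds [q b]. *)
Lemma q_le_Phi A b : max_qpositive form A -> ((q b)%:E <= Phi form iota A b)%E.
Proof.
move=> mA; have [Ab|/existsNP[c /not_implyP[Ac /negP]]] :=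
    pselect (forall c, A c -> 0 <= q (b - c)).
  apply: le_trans (Phi_ge simonsB b (max_qpositive_mem mA Ab)).
  by rewrite lee_fin /Defs.q; lra.
rewrite -ltNge qB => bc; apply: le_trans (Phi_ge simonsB b Ac).
by rewrite lee_fin form_sym; lra.
Qed.

Lemma Lambda_max_enlargement A : max_qpositive form A ->
  Lambda form (max_enlargement form A) = Phi form iota A.
Proof.
move=> mA; apply/funext => b; apply/eqP; rewrite eq_le; apply/andP; split.
  have := q_le_Phi b mA; case E : (Phi form iota A b) => [p| |] //; last first.
    by move=> _; rewrite leey.
  rewrite lee_fin -subr_ge0 => p0.
  have -> : p%:E = ((NngNum p0)%:num + q b)%:E by rewrite /= subrK.
  apply: Lambda_le => c Ac /=; have := Phi_ge simonsB b Ac.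
  by rewrite E lee_fin qB (form_sym form c b); lra.
apply: Lambda_ge => e eb; apply: (Phi_le simonsB) => a /eb.
by rewrite qB (form_sym form a b); lra.
Qed.

(** Convexity of [h] at the two points is the transportation formula; the new
    parameter is nonnegative because [h] majorizes [q]. *)
Lemma calH_enlargement A h : calH form A h ->
  enlargements form A (fun e => [set b | (h b <= (e%:num + q b)%:E)%E]).
Proof.
move=> [/convex_funP ch _ hq hA]; split=> [e a /hA /= ->|e1 e2 e12 b /=|].
- by rewrite lee_fin lerDr.
- by move=> /le_trans; apply; rewrite lee_fin lerD2r.
move=> e1 e2 b1 b2 a1 a2 /= h1 h2 a10 a20 a12.
have := ch _ _ _ _ _ _ h1 h2 a10 a20 a12.
set e := a1 * e1%:num + a2 * e2%:num + a1 * a2 * q (b1 - b2) => hb.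
have eE : a1 * (e1%:num + q b1) + a2 * (e2%:num + q b2) =
    e + q (a1 *: b1 + a2 *: b2) by rewrite q_conv // /e; ring.
rewrite eE in hb.
have e0 : 0 <= e by have := le_trans (hq _) hb; rewrite lee_fin; lra.
by exists (NngNum e0).
Qed.

Lemma min_enlargement_sub_star_Theta A e b : qpositive form A ->
  min_enlargement form A e b -> (star_Theta form A b <= (e%:num + q b)%:E)%E.
Proof.
by move=> qA /(_ _ (calH_enlargement (star_Theta_calH simonsB qA))).
Qed.

(** An intersection of enlargements is one as soon as there is one, which is
    needed for the nonnegativity of the new parameter; [star_Theta] provides
    it. *)
Lemma min_enlargement_enlargement A : qpositive form A ->
  enlargements form A (min_enlargement form A).
Proof.
move=> qA; split=> [e a Aa E [AE _ _]|e1 e2 e12 b be E EA|].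
- exact: AE.
- by have [_ mE _] := EA; apply: (mE _ _ e12); exact: be.
move=> e1 e2 b1 b2 a1 a2 h1 h2 a10 a20 a12.
have tr E : enlargements form A E -> _ := fun EA => let: And3 _ _ t := EA in
  t e1 e2 b1 b2 a1 a2 (h1 _ EA) (h2 _ EA) a10 a20 a12.
have [e ee _] := tr _ (calH_enlargement (star_Theta_calH simonsB qA)).
exists e => // E EA; have [e' ee' Ee'] := tr _ EA.
by have -> : e = e' by apply/val_inj; rewrite /= ee ee'.
Qed.

(** The homeomorphism [(e, b) |-> (b, e + q b)] carries the graph of the
    smallest enlargement into the closed epigraph of [star_Theta]. *)
Lemma star_Theta_le_Lambda A b : qpositive form A ->
  (star_Theta form A b <= Lambda form (closure_mf (min_enlargement form A)) b)%E.
Proof.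
move=> qA; apply: Lambda_ge => e.
pose g (p : R * B) : B * R^o := (p.2, p.1 + q p.2).
have cg : {for (e%:num, b), continuous g}.
  apply: (@cvg_pair _ _ _ _ (nbhs b) (nbhs (e%:num + q b : R^o))).
    exact: cvg_snd.
  apply: cvgD; first exact: cvg_fst.
  apply: (@cvg_comp _ _ _ snd q _ (nbhs b)); first exact: cvg_snd.
  exact: q_continuous simonsB b.
have gE : g @` graph_mf (min_enlargement form A) `<=` epi (star_Theta form A).
  by move=> _ [[_ c] [e' /= <- /(min_enlargement_sub_star_Theta qA) ?] <-].
move=> /(closure_continuous_image cg gE).
exact/lower_semicontinuous_closure_epi/star_Theta_lsc.
Qed.

Lemma Lambda_min_enlargement_convex A : qpositive form A ->
  convex_fun (Lambda form (min_enlargement form A)).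
Proof.
move=> qA; apply/convex_funP => x y r s a b xr ys a0 b0 ab.
have [_ _ tr] := min_enlargement_enlargement qA.
apply/lee_addgt0Pr => eta eta0; rewrite -EFinD.
have [|e1 Ee1 e1r] := @Lambda_lt _ _ form (min_enlargement form A) x (r + eta).
  by apply: le_lt_trans xr _; rewrite lte_fin ltrDl.
have [|e2 Ee2 e2s] := @Lambda_lt _ _ form (min_enlargement form A) y (s + eta).
  by apply: le_lt_trans ys _; rewrite lte_fin ltrDl.
have [e ee Ee] := tr _ _ _ _ _ _ Ee1 Ee2 a0 b0 ab.
apply: le_trans (Lambda_le form Ee) _; rewrite lee_fin ee q_conv //.
have : a * (e1%:num + q x) <= a * (r + eta) by rewrite ler_wpM2l // ltW.
have : b * (e2%:num + q y) <= b * (s + eta) by rewrite ler_wpM2l // ltW.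
have : a * eta + b * eta = eta by rewrite -mulrDl ab mul1r.
by lra.
Qed.

Lemma Lambda_min_enlargement_le A b : qpositive form A ->
  (Lambda form (min_enlargement form A) b <= (q b)%:E + indicator A b)%E.
Proof.
move=> qA; rewrite /indicator; case: ifPn => [|_]; last by rewrite addey ?leey.
rewrite inE adde0 => Ab; have [AE _ _] := min_enlargement_enlargement qA.
by have := Lambda_le form (AE (NngNum (lexx 0)) _ Ab); rewrite /= add0r.
Qed.

(** The inverse homeomorphism [(b, r) |-> (r - q b, b)] carries the epigraph of
    the convex hull of [q] plus the indicator into the closure of the graph of
    the smallest enlargement: the infimum defining [Lambda] need not be attained,
    but monotonicity puts every point strictly above it in the graph. *)
Lemma Lambda_le_star_Theta A b : qpositive form A ->
  (Lambda form (closure_mf (min_enlargement form A)) b <= star_Theta form A b)%E.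
Proof.
move=> qA; have sq := q_le_star_Theta simonsB b qA.
rewrite {1}(star_Theta_hull simonsB qA).
set co := convex_hull _.
apply: le_ereal_inf_tmp => _ [r clr <-].
have r0 : 0 <= r - q b.
  rewrite subr_ge0 -lee_fin; apply: le_trans sq _.
  rewrite (star_Theta_hull simonsB qA); suff : epi (lsc_hull co) (b, r) by [].
  by rewrite epi_lsc_hull.
suff : closure_mf (min_enlargement form A) (NngNum r0) b.
  by move/(Lambda_le form); rewrite /= subrK.
pose g (p : B * R^o) : R * B := (p.2 - q p.1, p.1).
have cg : {for (b, r), continuous g}.
  apply: (@cvg_pair _ _ _ _ (nbhs (r - q b : R^o)) (nbhs b)); last first.
    exact: cvg_fst.
  apply: cvgB; first exact: cvg_snd.
  apply: (@cvg_comp _ _ _ fst q _ (nbhs b)); first exact: cvg_fst.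
  exact: q_continuous simonsB b.
rewrite /closure_mf /=.
have /closure_id -> := @closed_closure _ (graph_mf (min_enlargement form A)).
apply: (closure_continuous_image cg _ clr) => _ [[c s] /= cs <-].
have {}cs : (Lambda form (min_enlargement form A) c <= s%:E)%E.
  apply: le_trans cs; apply: convex_hull_max => [|y].
    exact: Lambda_min_enlargement_convex.
  exact: Lambda_min_enlargement_le.
have [_ mono _] := min_enlargement_enlargement qA.
have near_graph (eta : R) : 0 < eta ->
    graph_mf (min_enlargement form A) (s - q c + eta, c).
  move=> eta0; have [|e Ee es] := @Lambda_lt _ _ form (min_enlargement form A) c (s + eta).
    by apply: le_lt_trans cs _; rewrite lte_fin ltrDl.
  have t0 : 0 <= s - q c + eta by have : 0 <= e%:num by []; lra.
  exists (NngNum t0) => //; apply: mono Ee => /=; lra.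
move=> U [[V W] /= [/nbhs_ballP[d /= d0 dV] Wc] VWU].
exists (s - q c + d / 2, c); split; first by apply: near_graph; rewrite divr_gt0.
apply: VWU; split; last exact: nbhs_singleton.
by apply: dV; rewrite /ball /= opprD addNKr normrN gtr0_norm ?divr_gt0 //; lra.
Qed.

(** Convexity of [h] on the segment from [a] to [b], compared with [h >= q] at
    the point of parameter [t], gives the bound up to [t * q (a - b)], and [t]
    can be taken small. *)
Lemma calH_ge_affine A h a b (r : R) : calH form A h -> A a ->
  (h b <= r%:E)%E -> form a b - q a <= r.
Proof.
move=> [/convex_funP ch _ hq hA] Aa br.
have ha : (h a <= (q a)%:E)%E by rewrite (hA _ Aa).
have key (t : R) : 0 < t -> t <= 1 -> form a b - q a + t * q (a - b) <= r.
  move=> t0 t1; have st : (1 - t) + t = 1 by rewrite subrK.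
  have s0 : 0 <= 1 - t by rewrite subr_ge0.
  have := le_trans (hq _) (ch _ _ _ _ _ _ ha br s0 (ltW t0) st).
  rewrite q_conv // lee_fin => tt.
  have : t * (form a b - q a + t * q (a - b)) <= t * r.
    have -> : form a b = q a + q b - q (a - b) by rewrite qB; lra.
    by lra.
  by rewrite ler_pM2l.
rewrite leNgt -subr_gt0; apply/negP; set k := _ - r => k0.
have d0 : 0 < k + `|q (a - b)| by rewrite ltr_wpDr.
(* This parameter is at most 1 and makes the error term smaller than [k]. *)
have := key (k / (k + `|q (a - b)|)).
rewrite divr_gt0 // ler_pdivrMr // mul1r lerDl normr_ge0 => /(_ isT isT).
apply/negP; rewrite -ltNge -subr_gt0.
have -> : form a b - q a + k / (k + `|q (a - b)|) * q (a - b) - r =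
    k * (k + `|q (a - b)| + q (a - b)) / (k + `|q (a - b)|).
  by rewrite /k; field; rewrite gt_eqF.
rewrite divr_gt0 // mulr_gt0 //; have := ler_norm (- q (a - b)).
by rewrite normrN; lra.
Qed.

Lemma conj_at_calH A h : max_qpositive form A -> calH form A h ->
  calH form A (conj_at form h).
Proof.
move=> mA hH; have [ch lh hq hA] := hH.
have conjE : conj_at form h = (fun c =>
    ereal_sup [set ((iota b c)%:E - h b)%E | b in [set: B]]).
  apply/funext => c; congr ereal_sup; apply: eq_imagel => b _.
  by rewrite (simons_iotaE simonsB) form_sym.
have hge c : ((q c)%:E <= conj_at form h c)%E.
  apply: le_trans (q_le_Phi c mA) _.
  apply: ge_ereal_sup => _ [a Aa <-]; rewrite (simons_iotaE simonsB).
  by apply: ereal_sup_ubound; exists a => //; rewrite (hA _ Aa).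
split=> //; first by rewrite conjE; exact: sup_affine_convex.
  by rewrite conjE; exact: sup_affine_lsc.
move=> a Aa; apply/eqP; rewrite eq_le hge andbT.
apply: ge_ereal_sup => _ [b _ <-].
have := hq b; have := calH_ge_affine (b := b) hH Aa.
case: (h b) => [r| |] // bound _; last by rewrite addeNy leNye.
by rewrite -EFinB lee_fin form_sym; have := bound r (lexx _); lra.
Qed.
End MaximallyPositive.

Theorem proposition18 (R : realType) (B : completeNormedModType R)
    (form : {symmetric B}) (iota : {linear B -> dual B})
    (simonsB : simons_space form iota)
    (A : set B) (qA : qpositive form A) :
  [/\ star_Theta form A = pointwise_sup
        [set h : B -> \bar R | [/\ proper_fun h, convex_fun h,
           lower_semicontinuous h, (forall b, ((q form b)%:E <= h b)%E) &
           A `<=` contact form h]],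
      star_Theta form A =
        lsc_hull (convex_hull (fun b => ((q form b)%:E + indicator A b)%E)) &
      max_qpositive form A ->
        [/\ Lambda form (max_enlargement form A) = Phi form iota A,
            Lambda form (closure_mf (min_enlargement form A)) =
              star_Theta form A &
            forall h : B -> \bar R, calH form A h -> calH form A (conj_at form h)]].
Proof.
split; [exact: star_Theta_sup simonsB _ qA|exact: star_Theta_hull simonsB _ qA|].
move=> mA; split; first exact: Lambda_max_enlargement.
  apply/funext => b; apply/eqP; rewrite eq_le (Lambda_le_star_Theta simonsB _ qA) /=.
  exact: star_Theta_le_Lambda simonsB _ _ qA.
by move=> h; exact: conj_at_calH simonsB _ _ mA.
Qed.
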